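(* Let $f: 2^X \to \mathbb{R}_{\ge 0}$ be any monotone non-negative submodular function with $f(\emptyset)=0$ on a finite ground set $X$, let $\mathbf{p}=(p_e)_{e\in X}$ be any activation probabilities, and let $\mathcal{F}$ be any prefix-closed probing constraint. Then the adaptivity gap of the stochastic probing problem $(X,\mathbf{p},f,\mathcal{F})$ is at most $3$: the expected value of the optimal adaptive strategy is at most $3$ times the expected value of the best non-adaptive strategy.
   Context: Stochastic probing problem: a finite ground set $X$ with $|X|=n$; each element $e\in X$ is active independently with known probability $p_e$ (and inactive with probability $q_e=1-p_e$); its status is revealed only when $e$ is probed. A probing constraint $\mathcal{F}$ is a family of sequences of distinct elements of $X$; it is prefix-closed if every prefix of a sequence in $\mathcal{F}$ is in $\mathcal{F}$. An adaptive strategy is a binary decision tree whose internal nodes are labelled by elements (with a yes-arc taken if the element is active and a no-arc otherwise), no element repeats on a root-leaf path, and the sequence of elements on every root-leaf path belongs to $\mathcal{F}$; on reaching a leaf with set $A$ of observed active elements, it receives $f^{\max}(A):=\max_{T\subseteq A} f(T)$. A non-adaptive strategy is a fixed sequence $\sigma\in\mathcal{F}$, all of whose elements are probed; its value is $\mathbb{E}[f^{\max}(A\cap \sigma)]$ where $A$ is the random set of active elements. The adaptivity gap is the ratio of the best expected adaptive value to the best expected non-adaptive value. *)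

(* Defs.v *)
From HB Require Import structures.
From mathcomp Require Import all_boot all_order all_algebra.
From mathcomp Require Import all_classical reals.

Set Implicit Arguments.
Unset Strict Implicit.
Unset Printing Implicit Defensive.

Import Order.TTheory GRing.Theory Num.Theory.
Local Open Scope ring_scope.

Section SetFunctions.
Variables (R : realType) (X : finType).
Implicit Types (f : {set X} -> R) (A B : {set X}).

Definition nonnegative f := forall A, 0 <= f A.

Definition monotone f := forall A B, A \subset B -> f A <= f B.

Definition submodular f :=
  forall A B, f (A :|: B) + f (A :&: B) <= f A + f B.

(* The default value f finset.set0 is itself one of the values f T, T \subset A, so
   this is a genuine maximum for every f. *)
Definition fmax f A : R :=
  \big[Num.max/f finset.set0]_(T : {set X} | T \subset A) f T.

End SetFunctions.

Section Constraints.
Variable X : finType.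

Definition probing_constraint (F : set (seq X)) := forall s, F s -> uniq s.

Definition prefix_closed (F : set (seq X)) :=
  forall s t, prefix s t -> F t -> F s.

Inductive strategy :=
  | Leaf
  | Node (e : X) (yes no : strategy).

Fixpoint root_leaf_paths (t : strategy) : seq (seq X) :=
  match t with
  | Leaf => [:: [::]]
  | Node e yes no =>
      [seq e :: s | s <- root_leaf_paths yes ++ root_leaf_paths no]
  end.

Definition feasible (F : set (seq X)) (t : strategy) :=
  forall s, s \in root_leaf_paths t -> uniq s /\ F s.

(* The active elements observed along the root-leaf path followed by t when A
   is the set of active elements. *)
Fixpoint observed (t : strategy) (A : {set X}) : {set X} :=
  match t with
  | Leaf => finset.set0
  | Node e yes no =>
      if e \in A then e |: observed yes A else observed no A
  end.

End Constraints.

Arguments Leaf {X}.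

Section Probing.
Variables (R : realType) (X : finType).
Variables (p : X -> R) (f : {set X} -> R) (F : set (seq X)).

Definition activation_probabilities := forall e, 0 <= p e <= 1.

(* The law of the random set of active elements: the statuses of the elements
   are independent. *)
Definition prob_active (A : {set X}) : R :=
  (\prod_(e in A) p e) * \prod_(e in ~: A) (1 - p e).

Definition expect (g : {set X} -> R) : R :=
  \sum_(A : {set X}) prob_active A * g A.

Definition adaptive_value (t : strategy X) : R :=
  expect (fun A => fmax f (observed t A)).

Definition nonadaptive_value (s : seq X) : R :=
  expect (fun A => fmax f (A :&: [set x in s]%SET)).

(* Both optima are attained as soon as some strategy is feasible: see
   adaptive_opt_attained and nonadaptive_opt_attained below. *)
Definition adaptive_opt : R :=
  sup [set adaptive_value t | t in feasible F]%classic.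

Definition nonadaptive_opt : R :=
  sup [set nonadaptive_value s | s in F]%classic.

End Probing.

Section Attained.
Variable R : realType.

Lemma sup_fin_attained (J : Type) (I : finType) (D : set J) (g : J -> I)
    (V : I -> R) :
  (exists j, D j) ->
  exists2 j, D j & sup [set V (g j) | j in D]%classic = V (g j).
Proof.
move=> [j0 Dj0]; pose P i := `[< exists2 j, D j & g j = i >].
have P0 : P (g j0) by apply/asboolP; exists j0.
have [i /asboolP[j Dj <-] Hmax] := arg_maxP V P0.
exists j => //; apply/le_anti/andP; split.
  apply: ge_sup; first by exists (V (g j)), j.
  by move=> _ [k Dk <-]; apply: Hmax; apply/asboolP; exists k.
apply: ub_le_sup; last by exists j.
exists (V (g j)) => _ [k Dk <-].
by apply: Hmax; apply/asboolP; exists k.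
Qed.

Variables (X : finType) (p : X -> R) (f : {set X} -> R) (F : set (seq X)).

Lemma nonadaptive_opt_attained :
  (exists s, F s) ->
  exists2 s, F s & nonadaptive_opt p f F = nonadaptive_value p f s.
Proof.
exact: (@sup_fin_attained _ _ F (fun s => [set x in s]%SET)
  (fun B => expect p (fun A => fmax f (A :&: B)))).
Qed.

Lemma adaptive_opt_attained :
  prefix_closed F -> (exists s, F s) ->
  exists2 t, feasible F t & adaptive_opt p f F = adaptive_value p f t.
Proof.
move=> F_prefix [s Fs].
pose g (t : strategy X) : {ffun {set X} -> {set X}} := [ffun A => observed t A].
pose V (h : {ffun {set X} -> {set X}}) := expect p (fun A => fmax f (h A)).
have VE t : V (g t) = adaptive_value p f t.
  by apply: eq_bigr => A _; rewrite ffunE.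
have feasL : feasible F Leaf.
  by move=> u; rewrite inE => /eqP ->; split=> //; apply: F_prefix (prefix0s s) Fs.
have [|t tF supE] := @sup_fin_attained _ _ (feasible F) g V; first by exists Leaf.
exists t => //; rewrite -VE -supE; congr (sup _); apply: eq_imagel => u _.
by rewrite VE.
Qed.

End Attained.

(* Main.v *)
Require Import Defs.
From HB Require Import structures.
From mathcomp Require Import all_boot all_order all_algebra.
From mathcomp Require Import all_classical reals.
From mathcomp Require Import ring lra.

Set Implicit Arguments.
Unset Strict Implicit.
Unset Printing Implicit Defensive.

Import Order.TTheory GRing.Theory Num.Theory.
Local Open Scope ring_scope.

(** Given an adaptive tree [t], draw a random root-leaf path by running [t] on
    one random active set, and probe that path non-adaptively on an independent
    active set.  Let [adap t S] and [algo t S] be the expected values of the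
    tree and of this random path when the elements of [S] have been collected
    beforehand.  Induction on [t] gives
      [adap t S + f S <= 2 * algo t S],
    so that some path of [t] has at least half the value of [t].  At a node
    labelled [e], if the tree sees [e] active but the random path does not, the
    tree gains the marginal value of [e] over the path; this has probability
    [p (1 - p)] and is paid for by the equally likely opposite event. *)

Section SetFunctionLemmas.
Variables (R : realType) (X : finType) (f : {set X} -> R).
Implicit Types (A S : {set X}).

Lemma fmax_monotone A : monotone f -> fmax f A = f A.
Proof.
move=> f_mono; apply/le_anti/andP; split; last exact: le_bigmax_cond.
by apply: bigmax_le => [|T TA]; apply: f_mono => //; apply: finset.sub0set.
Qed.

(** When [d = e] or one of them lies in [S], the intersection of [d |: S] and [e |: S] can exceed
    [S]; monotonicity absorbs the excess. *)
Lemma submodular_marginal d e S : monotone f -> submodular f ->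
  f (d |: (e |: S)) + f S <= f (d |: S) + f (e |: S).
Proof.
move=> f_mono f_sub; apply: le_trans (f_sub (d |: S) (e |: S)).
apply: lerD; apply: f_mono; apply/fintype.subsetP => x; rewrite !inE.
  by case/or3P => ->; rewrite ?orbT.
by move=> ->; rewrite !orbT.
Qed.

End SetFunctionLemmas.

Section Expectation.
Variables (R : realType) (X : finType) (p : X -> R).
Implicit Types (A : {set X}) (h : {set X} -> R).

(** Cross-multiplied so that it survives [p e = 0] and [p e = 1]. *)
Lemma prob_active_setU1 e A : e \notin A ->
  p e * prob_active p A = (1 - p e) * prob_active p (e |: A).
Proof.
move=> eA; rewrite /prob_active big_setU1 //=.
rewrite (big_setD1 e (A := ~: A)) ?inE //=.
have -> : ~: (e |: A) = (~: A) :\ e by apply/setP=> x; rewrite !inE negb_or.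
by ring.
Qed.

Lemma sum_set_setU1 e h :
  \sum_A h A = \sum_(A : {set X} | e \notin A) (h (e |: A) + h A).
Proof.
rewrite big_split /= (bigID (fun A : {set X} => e \in A)) /=; congr (_ + _).
rewrite (reindex_onto (fun A => e |: A) (fun A => A :\ e)) => [|A /finset.setD1K //].
apply: eq_bigl => A; rewrite finset.setU11 /=.
case: (boolP (e \in A)) => eA; last by rewrite finset.setU1K ?eqxx.
by apply/negbTE/eqP => eqA; move: eA; rewrite -eqA !inE eqxx.
Qed.

Lemma expect_condition e h :
  expect p h = p e * expect p (fun A => h (e |: A))
             + (1 - p e) * expect p (fun A => h (A :\ e)).
Proof.
rewrite /expect !(sum_set_setU1 e) !mulr_sumr -big_split /=.
apply: eq_bigr => A eA; have := prob_active_setU1 eA.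
have -> : e |: (e |: A) = e |: A by rewrite finset.setUA finset.setUid.
have -> : (e |: A) :\ e = A by rewrite finset.setU1K.
have -> : A :\ e = A.
  by apply/setP => x; rewrite !inE; case: eqP => // ->; rewrite (negbTE eA).
by set a := prob_active p A; set b := prob_active p _ => H; ring: H.
Qed.

Lemma eq_expect h h' : h =1 h' -> expect p h = expect p h'.
Proof. by move=> hh'; apply: eq_bigr => A _; rewrite hh'. Qed.

Lemma prob_active_sum1 : \sum_A prob_active p A = 1.
Proof.
transitivity (\prod_e (p e + (1 - p e))).
  rewrite bigA_distr; apply: eq_bigr => A _; rewrite /prob_active.
  rewrite [RHS](bigID (fun e => e \in A)) /=; congr (_ * _).
    by apply: eq_bigr => e ->.
  by apply: eq_big => [e|e]; rewrite inE // => /negbTE ->.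
by rewrite big1 // => e _; ring.
Qed.

Lemma expect_cst c : expect p (fun=> c) = c.
Proof. by rewrite /expect -mulr_suml prob_active_sum1 mul1r. Qed.

Lemma prob_active_ge0 A : activation_probabilities p -> 0 <= prob_active p A.
Proof.
move=> p01; apply: mulr_ge0; apply: prodr_ge0 => e _.
  by case/andP: (p01 e).
by rewrite subr_ge0; case/andP: (p01 e).
Qed.

End Expectation.

Section Recursion.
Variables (R : realType) (X : finType) (p : X -> R) (f : {set X} -> R).
Implicit Types (A S : {set X}) (h : {set X} -> R) (s : seq X) (t : strategy X).

Definition probe e h S := p e * h (e |: S) + (1 - p e) * h S.

Fixpoint seq_value s : {set X} -> R :=
  if s is e :: s' then probe e (seq_value s') else f.

Fixpoint adap t S : R :=
  if t is Node e yes no then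
    p e * adap yes (e |: S) + (1 - p e) * adap no S
  else f S.

(* The branch taken by the path is drawn independently of the status of [e]
   recorded by [probe e]. *)
Fixpoint algo t : {set X} -> R :=
  if t is Node e yes no then
    probe e (fun S => p e * algo yes S + (1 - p e) * algo no S)
  else f.

Lemma seq_valueE s S : uniq s ->
  expect p (fun A => f (S :|: A :&: [set x in s]%SET)) = seq_value s S.
Proof.
elim: s S => [|e s IHs] S /=.
  rewrite -[RHS](expect_cst p) => _; apply: eq_expect => A; congr (f _).
  by apply/setP => x; rewrite !inE andbF orbF.
case/andP=> es s_uniq; rewrite (expect_condition p e) /probe -!IHs //.
congr (_ * _ + _ * _); apply: eq_expect => A; congr (f _); apply/setP => x;
  rewrite !inE; case: eqP => [->|_]; rewrite ?(negbTE es) ?orbT ?andbF ?orbF //=.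
Qed.

Lemma path_exists t : exists s, s \in root_leaf_paths t.
Proof.
elim: t => [|e y [s sy] n _]; first by exists [::]; rewrite inE.
by exists (e :: s); rewrite /= map_f // mem_cat sy.
Qed.

Lemma path_yes e y n s :
  s \in root_leaf_paths y -> e :: s \in root_leaf_paths (Node e y n).
Proof. by move=> sy; rewrite /= map_f // mem_cat sy. Qed.

Lemma path_no e y n s :
  s \in root_leaf_paths n -> e :: s \in root_leaf_paths (Node e y n).
Proof. by move=> sn; rewrite /= map_f // mem_cat sn orbT. Qed.

(** Lets [adapE] forget the status of the root once it has been conditioned on, since no subtree
    probes it again. *)
Lemma observed_local e t A (B : {set X}) :
  (forall s, s \in root_leaf_paths t -> e \notin s) ->
  (forall x, x != e -> (x \in A) = (x \in B)) ->
  observed t A = observed t B.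
Proof.
move=> + AB; elim: t => [//|d y IHy n IHn] et /=.
have [s sy] := path_exists y.
have := et _ (path_yes d n sy); rewrite inE negb_or eq_sym => /andP[de _].
rewrite (AB d de) IHy ?IHn // => u u_in.
  by have := et _ (path_no d y u_in); rewrite inE negb_or => /andP[].
by have := et _ (path_yes d n u_in); rewrite inE negb_or => /andP[].
Qed.

Lemma adapE t S : (forall s, s \in root_leaf_paths t -> uniq s) ->
  expect p (fun A => f (S :|: observed t A)) = adap t S.
Proof.
elim: t S => [|e y IHy n IHn] S t_uniq.
  by rewrite -[RHS](expect_cst p); apply: eq_expect => A; rewrite finset.setU0.
rewrite (expect_condition p e) /= -IHy => [|s /(path_yes e n)/t_uniq /andP[] //].
rewrite -IHn => [|s /(path_no e y)/t_uniq /andP[] //].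
congr (_ * _ + _ * _); apply: eq_expect => A.
  rewrite finset.setU11 finset.setUCA finset.setUA; congr (f (_ :|: _)).
  apply: (@observed_local e) => [s /(path_yes e n)/t_uniq /andP[] //|x xe].
  by rewrite !inE (negbTE xe).
rewrite finset.setD11; congr (f (_ :|: _)).
apply: (@observed_local e) => [s /(path_no e y)/t_uniq /andP[] //|x xe].
by rewrite !inE xe.
Qed.

Hypotheses (f_mono : monotone f) (f_sub : submodular f).
Hypothesis p01 : activation_probabilities p.

(* [algo t] is a convex combination of the [seq_value s]; quantifying over all
   linear functionals [phi] makes the choice of [s] uniform in the random set
   collected before reaching [t]. *)
Lemma path_above_algo (phi : ({set X} -> R) -> R) t :
  (forall a b g h, phi (fun S => a * g S + b * h S) = a * phi g + b * phi h) ->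
  exists2 s, s \in root_leaf_paths t & phi (algo t) <= phi (seq_value s).
Proof.
elim: t phi => [|e y IHy n IHn] phi phi_lin; first by exists [::]; rewrite ?inE.
(* Probing [e] first is linear in the continuation, so [psi] is again an admissible functional for
   both subtrees. *)
pose psi g := phi (probe e g).
have psi_lin a b g h : psi (fun S => a * g S + b * h S) = a * psi g + b * psi h.
  rewrite /psi -phi_lin; congr phi; apply/funext => S; rewrite /probe; ring.
have [s sy les] := IHy psi psi_lin; have [u un leu] := IHn psi psi_lin.
have algoE : phi (algo (Node e y n))
    = p e * psi (algo y) + (1 - p e) * psi (algo n) by exact: psi_lin.
(* A convex combination is at most its larger term: follow that branch. *)
have := p01 e; case: (leP (psi (seq_value s)) (psi (seq_value u))) => su p01e.
  exists (e :: u); first exact: path_no.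
  by rewrite algoE -/(psi (seq_value u)); nra.
exists (e :: s); first exact: path_yes.
by rewrite algoE -/(psi (seq_value s)); nra.
Qed.

Lemma adap_setU1 t e S : adap t S <= adap t (e |: S).
Proof.
elim: t S => [|d y IHy n IHn] S /=; first by apply/f_mono/finset.subsetUr.
have /andP[p0 p1] := p01 d; rewrite finset.setUCA.
by apply: lerD; apply: ler_wpM2l => //; rewrite subr_ge0.
Qed.

(** Diminishing returns for the random path: its gain over [S] splits into marginals of single
    probes, each of which shrinks as [S] grows. *)
Lemma algo_setU1 t e S : algo t (e |: S) - f (e |: S) <= algo t S - f S.
Proof.
elim: t S => [|d y IHy n IHn] S /=; first by rewrite !subrr.
have /andP[p0 p1] := p01 d; rewrite /probe [d |: (e |: S)]finset.setUCA.
have := submodular_marginal e d S f_mono f_sub.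
have := IHy S; have := IHy (d |: S); have := IHn S; have := IHn (d |: S).
have q0 : 0 <= 1 - p d by rewrite subr_ge0.
move=> /(ler_wpM2l (mulr_ge0 p0 q0)) H1 /(ler_wpM2l (mulr_ge0 q0 q0)) H2.
move=> /(ler_wpM2l (mulr_ge0 p0 p0)) H3 /(ler_wpM2l (mulr_ge0 q0 p0)) H4.
by move=> /(ler_wpM2l p0) H5; nra.
Qed.

Lemma adap_le_algo t S : adap t S + f S <= 2 * algo t S.
Proof.
elim: t S => [|e y IHy n IHn] S /=; first lra.
have /andP[p0 p1] := p01 e; rewrite /probe.
have Hye := IHy (e |: S); have Hne := IHn (e |: S); have Hn := IHn S.
have Hn_mono := adap_setU1 n e S; have Hy_sub := algo_setU1 y e S.
have w0 : f S <= f (e |: S) by apply/f_mono/finset.subsetUr.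
have q0 : 0 <= 1 - p e by rewrite subr_ge0.
move: Hye Hne Hn Hn_mono Hy_sub w0.
set a := algo y (e |: S); set b := algo y S; set c := algo n (e |: S).
set d := algo n S; set u := adap y _; set v := adap n _; set v' := adap n S.
set g := f (e |: S); set g' := f S; set P := p e in p0 p1 q0 *.
move=> Hye Hne Hn Hn_mono Hy_sub w0.
(* The mixed events: [b] is the yes-branch with [e] not collected, [c] the no-branch with [e]
   collected. Both have weight [P * (1 - P)], so the loss [- g] in [Hb] cancels the [+ g] in
   [Hc]. *)
have Hb : u - g + 2 * g' <= 2 * b by lra.
have Hc : v' + g <= 2 * c by lra.
have H1 := ler_wpM2l (mulr_ge0 p0 p0) Hye.
have H2 := ler_wpM2l (mulr_ge0 p0 q0) Hb.
have H3 := ler_wpM2l (mulr_ge0 p0 q0) Hc.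
have H4 := ler_wpM2l (mulr_ge0 q0 q0) Hn.
(* Lowers the remaining [g] to [g'], whose weights over the four events then sum to 1. *)
have H5 := ler_wpM2l (mulr_ge0 p0 p0) w0.
by nra.
Qed.

End Recursion.

Theorem theorem1 (R : realType) (X : finType)
    (f : {set X} -> R) (p : X -> R) (F : set (seq X))
    (f_ge0 : nonnegative f) (f_mono : monotone f) (f_sub : submodular f)
    (f0 : f finset.set0 = 0)
    (p01 : activation_probabilities p)
    (F_uniq : probing_constraint F) (F_prefix : prefix_closed F) :
  adaptive_opt p f F <= 3 * nonadaptive_opt p f F.
Proof.
have [[s0 Fs0]|F_empty] := pselect (exists s, F s); last first.
  rewrite /adaptive_opt /nonadaptive_opt.
  (* With no feasible sequence both optima are the supremum of the empty set, which is 0. *)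
  suff [-> ->] : feasible F = classical_sets.set0 /\ F = classical_sets.set0.
    by rewrite !image_set0 sup0 mulr0.
  split; apply/seteqP; split=> //.
    by move=> t tF; apply: F_empty; have [s /tF[_]] := path_exists t; exists s.
  by move=> s Fs; apply: F_empty; exists s.
have F_ne : exists s, F s by exists s0.
have [t tF ->] := adaptive_opt_attained p f F_prefix F_ne.
have nonad_le s : F s -> nonadaptive_value p f s <= nonadaptive_opt p f F.
  move=> Fs; apply: ub_le_sup; last by exists s.
  (* [ub_le_sup] needs the values bounded; monotonicity bounds each by [f] of the whole ground
     set. *)
  exists (\sum_(A : {set X}) prob_active p A * f finset.setT) => _ [u _ <-].
  apply: ler_sum => A _; apply: ler_wpM2l; first exact: prob_active_ge0.
  by rewrite fmax_monotone //; apply/f_mono/finset.subsetT.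
have nonadE s : F s -> nonadaptive_value p f s = seq_value p f s finset.set0.
  move=> /F_uniq s_uniq; rewrite -seq_valueE //; apply: eq_expect => A.
  by rewrite fmax_monotone // finset.set0U.
have opt_ge0 : 0 <= nonadaptive_opt p f F.
  apply: le_trans (nonad_le _ Fs0); apply: sumr_ge0 => A _.
  by rewrite mulr_ge0 ?prob_active_ge0 // fmax_monotone.
have -> : adaptive_value p f t = adap p f t finset.set0.
  rewrite -adapE => [|s /tF[] //]; apply: eq_expect => A.
  by rewrite fmax_monotone // finset.set0U.
have [s st les] := @path_above_algo R X p f p01 (fun h => h finset.set0) t
  (fun _ _ _ _ => erefl).
have [_ Fs] := tF s st; have := nonad_le s Fs; rewrite nonadE // => sopt.
(* This yields the factor 2; [opt_ge0] relaxes it to 3. *)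
have := adap_le_algo f_mono f_sub p01 t finset.set0; rewrite f0.
by move: les sopt opt_ge0 => /=; lra.
Qed.
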